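(* Let $G$ be a (finite, simple) $8$-regular graph. Then $G$ admits a balanced $P_4$-decomposition; that is, there is a set $\mathcal{D}$ of pairwise edge-disjoint subgraphs of $G$, each of which is a path with exactly $4$ edges, such that every edge of $G$ belongs to some element of $\mathcal{D}$, and every vertex of $G$ is an end-vertex of exactly two paths of $\mathcal{D}$.
   Context: $P_\ell$ denotes the path with $\ell$ edges (so $P_4$ has $4$ edges and $5$ vertices). A $P_\ell$-decomposition of $G$ is a set of edge-disjoint subgraphs of $G$, each isomorphic to $P_\ell$, that cover the edge set of $G$. A $P_\ell$-decomposition of a $2\ell$-regular graph is balanced if each vertex is the end-vertex of exactly two of its paths. Graphs are finite and simple (no loops, no parallel edges). *)

(* Defs.v *)
(* Mathematical Components: a finite simple graph is a symmetric irreflexive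
   relation on a finType. *)
From mathcomp Require Import all_boot.
Set Implicit Arguments.
Unset Strict Implicit.
Unset Printing Implicit Defensive.

Definition regular (T : finType) (e : rel T) (d : nat) : Prop :=
  forall x : T, #|[set y | e x y]| = d.

Definition edges (T : finType) (e : rel T) : {set {set T}} :=
  [set [set x; y] | x in T, y in T & e x y].

(* A subgraph is a pair (vertex set, edge set). *)
Definition subgraph (T : finType) : Type := ({set T} * {set {set T}})%type.

Definition walk_edges (T : finType) (p : seq T) : {set {set T}} :=
  [set:: [seq [set u.1; u.2] | u <- zip p (behead p)]].

(* H is the path whose vertices, in order and without repetition, are p. *)
Definition traces (T : finType) (p : seq T) (H : subgraph T) : bool :=
  [&& uniq p, H.1 == [set:: p] & H.2 == walk_edges p].

(* The index l is the number of edges of the path. *)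
Definition is_path (T : finType) (l : nat) (H : subgraph T) : bool :=
  [exists p : l.+1.-tuple T, traces p H].

Definition end_vertex (T : finType) (l : nat) (H : subgraph T) (v : T) : bool :=
  [exists p : l.+1.-tuple T,
     traces p H && ((v == tnth p ord0) || (v == tnth p ord_max))].

(* In the first clause, every 2-set in H.2 has its two elements in H.1 as soon
   as H is a path, so H.2 \subset edges e makes H a subgraph. *)
Definition path_decomposition (T : finType) (e : rel T) (l : nat)
    (D : {set subgraph T}) : Prop :=
  [/\ forall H, H \in D -> is_path l H /\ H.2 \subset edges e,
      forall H K, H \in D -> K \in D -> H != K -> [disjoint H.2 & K.2]
    & forall a, a \in edges e -> exists2 H, H \in D & a \in H.2].

Definition balanced (T : finType) (l : nat) (D : {set subgraph T}) : Prop :=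
  forall v : T, #|[set H in D | end_vertex l H v]| = 2.

(* Main.v *)
Require Import Defs.
From mathcomp Require Import all_boot.

(* Split the edges of [G] into two 4-regular graphs [A] and [B], each with an
   orientation of in- and out-degree 2. For every vertex [v] take the two arcs of [A]
   leaving [v], and prolong each of them by an arc of [B] leaving its head, so that
   the arcs of [B] leaving [x] go one to each of the arcs of [A] entering [x]. This
   decomposes [G] into trails of length 4, two ending at each vertex, and it remains to
   choose the data so that they are paths. The arcs of [A] split into two permutations
   [f1] and [f2]; put [t = f2 \o f1^-1], so that the inner part of the trail of [v]
   joins some [x] to [t x]. The choice at [x] interacts only with those at [t x] and
   [t^-1 x], and all choices can be made coherently as soon as
   - [t] has no 2-cycle, that is, [A] has no square [v, v' -> x, x'];
   - the two edges from [x] to [t^-1 x] and [t^-2 x], if both in [B], are oriented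
     one into [x] and one out of [x].
   Both come from Euler splittings of graphs into trails with prescribed transitions. *)

(** * Euler splitting *)

(** [a] conjugates [g] to its inverse, so it permutes the orbits of [g], and [a d], [b d] share an
    orbit. That orbit is never the one of [d], so comparing the ranks of the two orbits gives the
    colour. *)
Lemma alternating_colouring {D : finType} (S : {set D}) (a b : D -> D) :
    involutive a -> involutive b ->
    {homo a : d / d \in S} -> {homo b : d / d \in S} ->
    {in S, forall d, a d != d} -> {in S, forall d, b d != d} ->
  exists c : pred D, {in S, forall d, c (a d) = ~~ c d /\ c (b d) = ~~ c d}.
Proof.
move=> aK bK aS bS a_fpf b_fpf; pose g d := a (b d).
have g_inj : injective g by exact: (inj_comp (inv_inj aK) (inv_inj bK)).
have it_inj m : injective (iter m g) by elim: m => //= m IH x y /g_inj/IH.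
have gag u : g (a (g u)) = a u by rewrite /g aK bK.
have itag m u : iter m g (a (iter m g u)) = a u.
  by elim: m u => // m IH u; rewrite iterSr /= gag IH.
have itS m d : d \in S -> iter m g d \in S.
  by move=> dS; elim: m => //= m IH; apply/aS/bS.
have apart d : d \in S -> ~~ fconnect g d (a d).
  (* If [a d] were the [k]-th iterate of [d], cancelling half of the iterations would make the
     midpoint [u] a fixed point of [a] for even [k], of [b] for odd [k]. *)
  move=> dS; apply/negP => /iter_findex; set k := findex _ _ _.
  rewrite -{1}(itag k./2 d) -{1}(odd_double_half k) -addnn addnCA iterD.
  move/it_inj; rewrite iterD.
  have /a_fpf := itS k./2 _ dS; have /b_fpf := itS k./2 _ dS.
  set u := iter _ g d => bu au.
  case: (odd k) => /= [/(inv_inj aK)/eqP | /esym/eqP]; first by rewrite (negPf bu).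
  by rewrite (negPf au).
pose rk d : nat := enum_rank (froot g d).
have rkP x y : reflect (rk x = rk y) (fconnect g x y).
  apply: (iffP (rootP (fconnect_sym g_inj))) => [eq_xy|]; first by rewrite /rk eq_xy.
  by move/val_inj/enum_rank_inj.
exists (fun d => rk d < rk (a d)) => d dS.
have lt_C : (rk (a d) < rk d) = ~~ (rk d < rk (a d)).
  have neq : rk d != rk (a d) by apply/eqP => /rkP; apply/negP/apart.
  by rewrite -leqNgt [RHS]leq_eqVlt eq_sym (negPf neq).
rewrite aK -[a (b d)]/(g d) -lt_C; split=> //.
have <- : rk d = rk (g d) by apply/rkP/fconnect1.
by have -> : rk (b d) = rk (a d) by apply/rkP; have := fconnect1 g (b d); rewrite /g bK.
Qed.

Definition flip (i : nat) : nat := if odd i then i.-1 else i.+1.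

(** Positions 2i and 2i+1 of [s] are partners. When [s] has even length, the default [d] of [nth]
    makes every element outside [s] its own partner. *)
Definition mate {D : eqType} (s : seq D) (d : D) : D := nth d s (flip (index d s)).

Lemma flipK : involutive flip.
Proof. by move=> i; rewrite /flip; case: i => //= i; case oi: (odd i) => /=; rewrite oi. Qed.

Lemma flip_neq i : flip i != i.
Proof. by rewrite /flip; case: ifP; case: i => //= i _; rewrite neq_ltn ltnSn ?orbT. Qed.

Lemma flip_ltn {n} i : ~~ odd n -> (flip i < n) = (i < n).
Proof.
move=> n_even; have lt j : j < n -> flip j < n.
  rewrite /flip; case: ifP => [_|j_even lt_jn]; first exact: leq_ltn_trans (leq_pred j).
  rewrite ltn_neqAle lt_jn andbT; apply: contra n_even => /eqP <- /=.
  by rewrite j_even.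
by apply/idP/idP => /lt //; rewrite flipK.
Qed.

Section Mate.
Variables (D : eqType) (s : seq D).
Hypotheses (s_uniq : uniq s) (s_even : ~~ odd (size s)).

Lemma mate_out d : d \notin s -> mate s d = d.
Proof. by rewrite -index_mem -(flip_ltn _ s_even) -leqNgt => ?; rewrite /mate nth_default. Qed.

Lemma mem_mate d : (mate s d \in s) = (d \in s).
Proof.
apply/idP/idP => [|ds]; first by apply: contraTT => ds; rewrite mate_out.
by rewrite mem_nth // flip_ltn // index_mem.
Qed.

Lemma mateK : involutive (mate s).
Proof.
move=> d; have [ds|ds] := boolP (d \in s); last by rewrite !mate_out // mem_mate.
have lt : flip (index d s) < size s by rewrite flip_ltn // index_mem.
by rewrite {1}/mate {2}/mate index_uniq // flipK nth_index.
Qed.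

Lemma mate_neq d : d \in s -> mate s d != d.
Proof.
move=> ds; have lt : flip (index d s) < size s by rewrite flip_ltn // index_mem.
rewrite -{2}(nth_index d ds) /mate nth_uniq ?index_mem //; exact: flip_neq.
Qed.
End Mate.

Lemma pairing {D : finType} {K : eqType} (S : {set D}) (k : D -> K) :
    (forall x, ~~ odd #|[set d in S | k d == x]|) ->
  exists b : D -> D, [/\ involutive b, {homo b : d / d \in S},
    {in S, forall d, b d != d} & {in S, forall d, k (b d) = k d}].
Proof.
move=> k_even; pose s x := enum [set d in S | k d == x].
have s_even x : ~~ odd (size (s x)) by rewrite -cardE.
have s_uniq x : uniq (s x) by apply: enum_uniq.
have mem_s d x : (d \in s x) = (d \in S) && (k d == x) by rewrite mem_enum inE.
pose b d := mate (s (k d)) d.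
have b_in d : d \in S -> (b d \in S) && (k (b d) == k d).
  by move=> dS; rewrite -mem_s mem_mate // mem_s dS eqxx.
have b_out d : d \notin S -> b d = d.
  by move=> dS; rewrite /b mate_out // mem_s (negPf dS).
exists b; split=> [d|d /b_in/andP[]//|d dS|d /b_in/andP[_ /eqP]//].
  have [dS|dS] := boolP (d \in S); last by rewrite !b_out.
  by have /andP[_ /eqP kb] := b_in _ dS; rewrite {1}/b kb mateK.
by rewrite mate_neq // mem_s dS eqxx.
Qed.

Lemma card_half {D : finType} (E : {set D}) (b : D -> D) (c : pred D) :
    involutive b -> {homo b : d / d \in E} -> {in E, forall d, c (b d) = ~~ c d} ->
  #|[set d in E | c d]|.*2 = #|E|.
Proof.
move=> bK bE cb; rewrite -addnn -{1}(card_imset _ (inv_inj bK)).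
rewrite -(cardsID [set d | c d] E) addnC; congr (_ + _); apply: eq_card => d.
  by rewrite !inE.
rewrite !inE; apply/imsetP/andP => [[u]|[cd dE]].
  by rewrite inE => /andP[uE cu] ->; rewrite cb // cu bE.
by exists (b d); rewrite ?bK // inE bE // cb.
Qed.

(* Euler's splitting: colour the arcs of closed trails alternately, where a
   trail leaves a fibre of [k1] or [k2] by the partner of the element it came from. *)
Lemma halving {D : finType} {K1 K2 : eqType} (S : {set D}) (k1 : D -> K1) (k2 : D -> K2) :
    (forall x, ~~ odd #|[set d in S | k1 d == x]|) ->
    (forall x, ~~ odd #|[set d in S | k2 d == x]|) ->
  exists2 C : {set D}, C \subset S &
    (forall x, #|[set d in C | k1 d == x]|.*2 = #|[set d in S | k1 d == x]|) /\
    (forall x, #|[set d in C | k2 d == x]|.*2 = #|[set d in S | k2 d == x]|).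
Proof.
move=> /pairing[a [aK aS a_neq ka]] /pairing[b [bK bS b_neq kb]].
have [c cP] := alternating_colouring S a b aK bK aS bS a_neq b_neq.
exists [set d in S | c d]; first by apply/subsetP => d; rewrite inE => /andP[].
split=> x.
  rewrite -(card_half [set d in S | k1 d == x] a c) // => [|d|d].
  - by congr (_.*2); apply: eq_card => d; rewrite !inE andbAC.
  - by rewrite !inE => /andP[dS kd]; rewrite aS // ka.
  by rewrite inE => /andP[/cP[]].
rewrite -(card_half [set d in S | k2 d == x] b c) // => [|d|d].
- by congr (_.*2); apply: eq_card => d; rewrite !inE andbAC.
- by rewrite !inE => /andP[dS kd]; rewrite bS // kb.
by rewrite inE => /andP[/cP[]].
Qed.

(** * Bisecting digraphs and orienting even graphs *)

Definition outs {T : finType} (r : rel T) (v : T) : {set T} := [set x | r v x].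
Definition ins {T : finType} (r : rel T) (x : T) : {set T} := [set v | r v x].

(** Keying an arc by its tail [v] and by whether its head lies in [P v] lets a single halving split
    both [outs r v] and its part [P v] evenly. *)
Lemma card_arcs_from {T : finType} (r : rel T) (P : T -> {set T}) v t :
  #|[set d in [set d : T * T | r d.1 d.2] | (d.1, d.2 \in P d.1) == (v, t)]|
    = #|[set x in outs r v | (x \in P v) == t]|.
Proof.
rewrite -(card_imset [set x in outs r v | _] (fun x y => @congr1 _ _ snd (v, x) (v, y))).
apply: eq_card => -[u y]; rewrite !inE /= xpair_eqE; apply/idP/imsetP => /=.
  by case/and3P=> ruy /eqP eq_uv eq_t; subst u; exists y; rewrite ?inE ?ruy.
by case=> x; rewrite !inE => /andP[rvx eq_t] [-> ->]; rewrite eqxx rvx.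
Qed.

Lemma card_arcs_to {T : finType} (r : rel T) (P : T -> {set T}) x t :
  #|[set d in [set d : T * T | r d.1 d.2] | (d.2, d.1 \in P d.2) == (x, t)]|
    = #|[set v in ins r x | (v \in P x) == t]|.
Proof.
rewrite -(card_imset [set v in ins r x | _] (fun u v => @congr1 _ _ fst (u, x) (v, x))).
apply: eq_card => -[u y]; rewrite !inE /= xpair_eqE; apply/idP/imsetP => /=.
  by case/and3P=> ruy /eqP eq_yx eq_t; subst y; exists u; rewrite ?inE ?ruy.
by case=> v; rewrite !inE => /andP[rvx eq_t] [-> ->]; rewrite eqxx rvx.
Qed.

Lemma even_parts {T : finType} (E P : {set T}) t :
  P \subset E -> ~~ odd #|E| -> ~~ odd #|P| -> ~~ odd #|[set x in E | (x \in P) == t]|.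
Proof.
move=> PE E_even P_even; have <- : (if t then P else E :\: P) = [set x in E | (x \in P) == t].
  apply/setP => x; rewrite !inE; case: t; last by rewrite inE eqbF_neg andbC.
  by rewrite eqb_id andb_idl //; apply: subsetP.
case: t => //; rewrite cardsD (setIidPr PE) oddB ?subset_leq_card //.
by rewrite (negPf E_even).
Qed.

Lemma half_parts {T : finType} (C E P : {set T}) :
    P \subset E ->
    (forall t, #|[set x in C | (x \in P) == t]|.*2 = #|[set x in E | (x \in P) == t]|) ->
  #|C|.*2 = #|E| /\ #|C :&: P|.*2 = #|P|.
Proof.
move=> PE half.
have IP (A : {set T}) : [set x in A | (x \in P) == true] = A :&: P.
  by apply/setP => x; rewrite !inE eqb_id.
have DP (A : {set T}) : [set x in A | (x \in P) == false] = A :\: P.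
  by apply/setP => x; rewrite !inE eqbF_neg andbC.
have := half true; have := half false; rewrite !IP !DP (setIidPr PE) => halfD halfI.
by split=> //; rewrite -(cardsID P C) -(cardsID P E) (setIidPr PE) doubleD halfI halfD.
Qed.

Lemma bisection {T : finType} (r : rel T) (P Q : T -> {set T}) :
    (forall v, [/\ ~~ odd #|outs r v|, P v \subset outs r v & ~~ odd #|P v|]) ->
    (forall x, [/\ ~~ odd #|ins r x|, Q x \subset ins r x & ~~ odd #|Q x|]) ->
  exists2 c : rel T, subrel c r &
    (forall v, #|outs c v|.*2 = #|outs r v| /\ #|outs c v :&: P v|.*2 = #|P v|) /\
    (forall x, #|ins c x|.*2 = #|ins r x| /\ #|ins c x :&: Q x|.*2 = #|Q x|).
Proof.
move=> rP rQ; pose S := [set d : T * T | r d.1 d.2].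
have [||C /subsetP CS [CP CQ]] :=
    halving S (fun d => (d.1, d.2 \in P d.1)) (fun d => (d.2, d.1 \in Q d.2)).
- by case=> v t; rewrite card_arcs_from; have [? ? ?] := rP v; apply: even_parts.
- by case=> x t; rewrite card_arcs_to; have [? ? ?] := rQ x; apply: even_parts.
pose c v x := (v, x) \in C.
have defC : C = [set d : T * T | c d.1 d.2] by apply/setP => -[v x]; rewrite inE.
exists c; first by move=> v x /CS; rewrite inE.
split=> [v|x].
  have [_ PE _] := rP v; apply: (half_parts _ _ _ PE) => t.
  by have := CP (v, t); rewrite defC !card_arcs_from.
have [_ QE _] := rQ x; apply: (half_parts _ _ _ QE) => t.
by have := CQ (x, t); rewrite defC !card_arcs_to.
Qed.

Lemma eq_set2 {T : finType} (x y z w : T) :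
  ([set x; y] == [set z; w]) = (x == z) && (y == w) || (x == w) && (y == z).
Proof.
apply/eqP/orP => [eqxy|[]/andP[/eqP-> /eqP->] //]; last exact: setUC.
have yzw : y \in [set z; w] by rewrite -eqxy set22.
have zxy : z \in [set x; y] by rewrite eqxy set21.
have wxy : w \in [set x; y] by rewrite eqxy set22.
have: x \in [set z; w] by rewrite -eqxy set21.
rewrite inE !in_set1 => /orP[]/eqP eqx; rewrite eqx eqxx /=; [left | right].
  by move: wxy yzw; rewrite !inE eqx => /orP[]/eqP-> //; rewrite orbb.
by move: zxy yzw; rewrite !inE eqx => /orP[]/eqP-> //; rewrite orbb.
Qed.

(** [halving] is applied to the ordered pairs of adjacent vertices, the second key being the
    underlying edge: its nonempty fibres are pairs of opposite arcs, of which the chosen half keeps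
    exactly one. *)
Lemma orientation {T : finType} (e : rel T) (P : T -> {set T}) :
    symmetric e -> irreflexive e ->
    (forall x, [/\ ~~ odd #|outs e x|, P x \subset outs e x & ~~ odd #|P x|]) ->
  exists2 o : rel T, forall x y, e x y = o x y (+) o y x &
    [/\ subrel o e, forall x, #|outs o x|.*2 = #|outs e x|, forall x, #|ins o x|.*2 = #|outs e x|
      & forall x, #|outs o x :&: P x|.*2 = #|P x|].
Proof.
move=> e_sym e_irr eP; pose S := [set d : T * T | e d.1 d.2].
have fibre x y : e x y -> [set d in S | [set d.1; d.2] == [set x; y]] = [set (x, y); (y, x)].
  move=> exy; apply/setP => -[z w]; rewrite !inE /= eq_set2 -!xpair_eqE.
  rewrite andb_idl // => /orP[]/eqP[-> ->] //; by rewrite e_sym.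
have neq x y : e x y -> (x, y) != (y, x).
  by move=> exy; apply/eqP => -[eq_xy _]; rewrite eq_xy e_irr in exy.
have [||C /subsetP CS [CP Ce]] :=
    halving S (fun d => (d.1, d.2 \in P d.1)) (fun d => [set d.1; d.2]).
- by case=> v t; rewrite card_arcs_from; have [? ? ?] := eP v; apply: even_parts.
- move=> X; have [|no] := boolP [exists d in S, [set d.1; d.2] == X].
    case/existsP=> -[x y]; rewrite inE /= => /andP[exy /eqP<-].
    by rewrite fibre // cards2 neq.
  rewrite (_ : [set _ in S | _] = set0) ?cards0 //; apply/setP => d; rewrite inE [RHS]inE.
  by apply: contraNF no => dP; apply/existsP; exists d.
pose o x y := (x, y) \in C.
have oe : subrel o e by move=> x y /CS; rewrite inE.
have oP x y : e x y = o x y (+) o y x.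
  have [exy|nexy] := boolP (e x y); last first.
    have := contraNF (oe x y) nexy; have := contraNF (oe y x); rewrite e_sym => /(_ nexy).
    by move=> -> ->.
  have := Ce [set x; y]; rewrite fibre // cards2 neq //.
  rewrite (_ : [set _ in C | _] = [set d in [set (x, y); (y, x)] | d \in C]).
    rewrite /o; case: (boolP (_ \in C)) => xyC; case: (boolP (_ \in C)) => yxC //=.
      rewrite (_ : [set _ in _ | _] = [set (x, y); (y, x)]) ?cards2 ?neq //.
      by apply/setP => d; rewrite !inE andb_idr // => /orP[]/eqP->.
    rewrite (_ : [set _ in _ | _] = set0) ?cards0 //.
    apply/setP => d; rewrite !inE; apply/negP => /andP[/orP[]/eqP-> dC].
      by rewrite dC in xyC.
    by rewrite dC in yxC.
  rewrite -fibre //; apply/setP => d; rewrite !inE.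
  have [dC|] := boolP (d \in C); last by rewrite andbF.
  by have := CS _ dC; rewrite inE => ->; rewrite andbT.
have defC : C = [set d : T * T | o d.1 d.2] by apply/setP => -[v x]; rewrite inE.
have out_half x : #|outs o x|.*2 = #|outs e x| /\ #|outs o x :&: P x|.*2 = #|P x|.
  have [_ PE _] := eP x; apply: (half_parts _ _ _ PE) => t.
  by have := CP (x, t); rewrite defC !card_arcs_from.
exists o => //; split=> // x; [exact: (out_half x).1 | | exact: (out_half x).2].
have defD : ins o x = outs e x :\: outs o x.
  apply/setP => y; rewrite !inE; move: (oP x y) (oe y x); rewrite (e_sym y x) => ->.
  by case: (o x y) (o y x) => [] [] //= /(_ isT).
have [<- _] := out_half x; rewrite defD cardsD (setIidPr _); last first.
  by apply/subsetP => y; rewrite !inE; apply: oe.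
by rewrite -(out_half x).1 -[X in X - _]addnn addnK.
Qed.

(** * Square-free 2-factors of 4-regular digraphs *)

Definition square {T : finType} (r : rel T) (Q : {set T} * {set T}) : bool :=
  [&& #|Q.1| == 2, #|Q.2| == 2 & [forall v in Q.1, Q.2 \subset outs r v]].

(** For a square [Q], this says that [A] contains exactly a perfect matching of its four arcs;
    toggling exchanges it with the other one and preserves degrees. *)
Definition alternates {T : finType} (A : rel T) (Q : {set T} * {set T}) : bool :=
  [forall v in Q.1, #|outs A v :&: Q.2| == 1] && [forall x in Q.2, #|ins A x :&: Q.1| == 1].

Definition toggle {T : finType} (A : rel T) (Q : {set T} * {set T}) : rel T :=
  fun v x => A v x (+) ((v \in Q.1) && (x \in Q.2)).

Definition two_regular {T : finType} (A : rel T) : Prop :=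
  (forall v, #|outs A v| = 2) /\ (forall x, #|ins A x| = 2).

Section Toggle.
Variables (T : finType).
Implicit Types (A : rel T) (Q N S : {set T} * {set T}).

Definition converse A : rel T := fun x v => A v x.
Definition flip_sides Q := (Q.2, Q.1).

Lemma half_of_pair (X Y : {set T}) :
  #|Y| = 2 -> #|X :&: Y| = 1 ->
  {in Y &, forall y z, (y \in X) = (z \in X) -> y = z}.
Proof.
move=> Y2 XY1 y z yY zY; have [yX zX|yX /esym zX] := boolP (y \in X).
  by apply: (card_le1_eqP _ : {in X :&: Y &, _}); rewrite ?XY1 ?inE ?yX ?yY -?zX ?zY.
have YX1 : #|Y :\: X| <= 1 by rewrite cardsD setIC XY1 Y2.
by apply: (card_le1_eqP YX1); rewrite inE ?yX ?zX.
Qed.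

Lemma outs_toggle_out A Q v : v \notin Q.1 -> outs (toggle A Q) v = outs A v.
Proof. by move=> vQ; apply/setP => x; rewrite !inE /toggle (negPf vQ) addbF. Qed.

Lemma outs_toggle A Q v : v \in Q.1 -> #|Q.2| = 2 -> #|outs A v :&: Q.2| = 1 ->
  #|outs (toggle A Q) v| = #|outs A v| /\ #|outs (toggle A Q) v :&: Q.2| = 1.
Proof.
move=> vQ Q2 AQ1; rewrite -(cardsID Q.2 (outs (toggle A Q) v)) -(cardsID Q.2 (outs A v)).
have -> : outs (toggle A Q) v :&: Q.2 = Q.2 :\: outs A v.
  by apply/setP => x; rewrite !inE /toggle vQ /= andbC; case: (x \in Q.2) (A v x) => [] [].
have -> : outs (toggle A Q) v :\: Q.2 = outs A v :\: Q.2.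
  by apply/setP => x; rewrite !inE /toggle vQ /=; case: (x \in Q.2) (A v x) => [] [].
by rewrite cardsD setIC AQ1 Q2.
Qed.

Lemma alternates_toggle A Q : #|Q.1| = 2 -> #|Q.2| = 2 -> alternates A Q ->
  two_regular A -> alternates (toggle A Q) Q /\ two_regular (toggle A Q).
Proof.
move=> Q1 Q2 /andP[/forall_inP altO /forall_inP altI] [A_out A_in].
have outP v : v \in Q.1 -> _ := fun vQ => outs_toggle A Q v vQ Q2 (eqP (altO v vQ)).
have conv x : ins (toggle A Q) x = outs (toggle (converse A) (flip_sides Q)) x.
  by apply/setP => v; rewrite !inE /toggle andbC.
have inP x : x \in Q.2 -> _ :=
  fun xQ => outs_toggle (converse A) (flip_sides Q) x xQ Q1 (eqP (altI x xQ)).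
split; [apply/andP; split; apply/forall_inP | split].
- by move=> v /outP[_ ->].
- by move=> x xQ; rewrite conv; have [_ ->] := inP _ xQ.
- move=> v; have [/outP[-> _] //|vQ] := boolP (v \in Q.1); by rewrite outs_toggle_out.
move=> x; rewrite conv; have [/inP[-> _] //|xQ] := boolP (x \in Q.2); first exact: A_in.
by rewrite outs_toggle_out //; apply: A_in.
Qed.

Lemma alternates_toggle_disjoint A Q S : [disjoint S.1 & Q.1] -> [disjoint S.2 & Q.2] ->
  alternates A S -> alternates (toggle A Q) S.
Proof.
move=> dis1 dis2 /andP[/forall_inP altO /forall_inP altI].
apply/andP; split; apply/forall_inP; [move=> v vS | move=> x xS].
  by rewrite outs_toggle_out ?altO // (disjointFr dis1 vS).
rewrite (_ : ins _ x = ins A x) ?altI //.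
by apply/setP => v; rewrite !inE /toggle (disjointFr dis2 xS) andbF addbF.
Qed.

(** By counting, a square takes up all arcs leaving [S.1] and all arcs entering [S.2]: it is a
    component of the bipartite graph of tails and heads. *)
Lemma square_outs A S : two_regular A -> square A S ->
  {in S.1, forall v, outs A v = S.2} /\ {in S.2, forall x, ins A x = S.1}.
Proof.
move=> [A_out A_in] /and3P[/eqP S1 /eqP S2 /forall_inP sub].
split=> [v vS|x xS]; apply/esym/eqP; rewrite eqEcard; first by rewrite sub // A_out S2.
rewrite A_in S1 andbT; apply/subsetP => v vS; rewrite inE.
by have := subsetP (sub v vS) x xS; rewrite inE.
Qed.

Lemma other_elt (X : {set T}) x : #|X| = 2 -> exists2 y, y \in X & y != x.
Proof.
move=> X2; have: 0 < #|X :\ x| by rewrite -(ltn_add2l (x \in X)) -cardsD1 X2; case: (x \in X).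
by case/card_gt0P=> y; rewrite !inE => /andP[]; exists y.
Qed.

(* Toggling [Q] merges the component [N] with the component of [A] through the
   opposite arc of [Q], so it creates no square. *)
Lemma toggle_squares A Q N v x :
    two_regular A -> #|Q.1| = 2 -> #|Q.2| = 2 -> alternates A Q -> square A N ->
    v \in N.1 -> v \in Q.1 -> x \in N.2 -> x \in Q.2 ->
  [set S | square (toggle A Q) S] \proper [set S | square A S].
Proof.
move=> Areg Q1 Q2 altQ sqN vN vQ xN xQ.
have [_ A'reg] := alternates_toggle _ _ Q1 Q2 altQ Areg.
have /andP[/forall_inP altO /forall_inP altI] := altQ.
(* Each vertex of [Q] has exactly one of its two arcs within [Q] in [A], so membership in [A] tells
   the two apart. *)
have rowP u : u \in Q.1 -> {in Q.2 &, forall y z, A u y = A u z -> y = z}.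
  move=> uQ y z yQ zQ eq_yz; apply: (half_of_pair (outs A u) _ Q2) => //.
    exact/eqP/altO.
  by rewrite !inE.
have colP y : y \in Q.2 -> {in Q.1 &, forall u w, A u y = A w y -> u = w}.
  move=> yQ u w uQ wQ eq_uw; apply: (half_of_pair (ins A y) _ Q1) => //.
    exact/eqP/altI.
  by rewrite !inE.
have [NO NI] := square_outs _ _ Areg sqN.
have AN u y : u \in N.1 -> A u y = (y \in N.2) by move/NO <-; rewrite inE.
have AN' u y : y \in N.2 -> A u y = (u \in N.1) by move/NI <-; rewrite inE.
have Avx : A v x by rewrite AN.
have N12 : #|N.1| = 2 /\ #|N.2| = 2 by case/and3P: sqN => /eqP-> /eqP->.
have [v2 v2N v2v] := other_elt _ v N12.1; have [x2 x2N x2x] := other_elt _ x N12.2.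
have v2Q : v2 \notin Q.1.
  by apply: contra v2v => v2Q; apply/eqP; apply: (colP x) => //; rewrite Avx AN.
have x2Q : x2 \notin Q.2.
  by apply: contra x2x => x2Q; apply/eqP; apply: (rowP v) => //; rewrite Avx AN.
apply/properP; split; last first.
  exists N; rewrite !inE //; apply/negP => /(square_outs _ _ A'reg)[/(_ v vN)/setP/(_ x) + _].
  by rewrite inE /toggle Avx vQ xQ xN.
apply/subsetP => S; rewrite !inE => sqS; have [SO SI] := square_outs _ _ A'reg sqS.
have AS u y : u \in S.1 -> toggle A Q u y = (y \in S.2) by move/SO <-; rewrite inE.
have AS' u y : y \in S.2 -> toggle A Q u y = (u \in S.1) by move/SI <-; rewrite inE.
have /and3P[S1 S2 _] := sqS; apply/and3P; split=> //.
apply/forall_inP => u uS; apply/subsetP => y yS; rewrite inE.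
(* Only an arc [u -> y] created by toggling is in question. For [u = v] the untouched arcs through
   [x2] and [v2] force [y] into [N.2]; otherwise [y = x] and they force [u] into [N.1]. Either way
   the arc was already in [A]. *)
have := AS u y uS; rewrite yS /toggle; case: (boolP (_ && _)) => [/andP[uQ yQ]|_]; last by rewrite addbF.
rewrite addbT => nAuy; have [eq_uv|neq_uv] := eqVneq u v.
  subst u; have x2S : x2 \in S.2 by rewrite -(AS v) // /toggle (negPf x2Q) andbF addbF AN.
  have v2S : v2 \in S.1 by rewrite -(AS' _ x2) // /toggle (negPf x2Q) andbF addbF AN.
  have := AS v2 y v2S; rewrite yS /toggle (negPf v2Q) addbF AN // => yN.
  by rewrite AN.
have nAux : ~~ A u x.
  by apply: contra neq_uv => Aux; apply/eqP; apply: (colP x) => //; rewrite Avx Aux.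
have eq_yx : y = x by apply: (rowP u) => //; rewrite (negPf nAuy) (negPf nAux).
subst y; have v2S : v2 \in S.1 by rewrite -(AS' _ x) // /toggle (negPf v2Q) addbF AN.
have x2S : x2 \in S.2 by rewrite -(AS v2) // /toggle (negPf v2Q) addbF AN.
have := AS u x2 uS; rewrite x2S /toggle (negPf x2Q) andbF addbF AN' // => uN.
by move: nAux; rewrite AN // xN.
Qed.
End Toggle.

Definition disjoint_squares {T : finType} (o : rel T) (F : {set {set T} * {set T}}) : bool :=
  [forall Q in F, square o Q] &&
  [forall Q in F, forall S in F, (Q != S) ==> [disjoint Q.1 & S.1] && [disjoint Q.2 & S.2]].

(* A maximal family of disjoint squares can be made alternating by Euler
   splitting; toggling its members then removes all remaining squares. *)
Lemma square_free_factor {T : finType} (o : rel T) :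
    (forall v, #|outs o v| = 4) -> (forall x, #|ins o x| = 4) ->
  exists2 A : rel T, subrel A o & two_regular A /\ injective (outs A).
Proof.
move=> o_out o_in.
have [F /andP[/forall_inP Fsq /forall_inP Fdis] Fmax] :
    {F | disjoint_squares o F & forall F', disjoint_squares o F' -> #|F'| <= #|F|}.
  have dis0 : disjoint_squares o set0.
    by apply/andP; split; apply/forall_inP => Q; rewrite inE.
  by case: (arg_maxnP (fun F : {set _} => #|F|) dis0) => F; exists F.
have {}Fdis Q S : Q \in F -> S \in F -> Q != S -> [disjoint Q.1 & S.1] && [disjoint Q.2 & S.2].
  by move=> /Fdis/forall_inP QF /QF/implyP.
have Fcard Q : Q \in F -> #|Q.1| = 2 /\ #|Q.2| = 2.
  by move=> /Fsq/and3P[/eqP-> /eqP->].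
(* As the squares of [F] are disjoint on either side, [P v] is the far side of the only one having
   [v] among its tails, or empty. *)
pose P v := \bigcup_(Q in F | v \in Q.1) Q.2.
pose R x := \bigcup_(Q in F | x \in Q.2) Q.1.
have defP Q v : Q \in F -> v \in Q.1 -> P v = Q.2.
  move=> QF vQ; rewrite /P (bigD1 Q) ?QF //= big1 ?setU0 // => S /andP[/andP[SF vS] neq].
  by have /andP[/disjointFr/(_ vS)] := Fdis S Q SF QF neq; rewrite vQ.
have defR Q x : Q \in F -> x \in Q.2 -> R x = Q.1.
  move=> QF xQ; rewrite /R (bigD1 Q) ?QF //= big1 ?setU0 // => S /andP[/andP[SF xS] neq].
  by have /andP[_ /disjointFr/(_ xS)] := Fdis S Q SF QF neq; rewrite xQ.
have sub_out Q v : Q \in F -> v \in Q.1 -> Q.2 \subset outs o v.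
  by move=> /Fsq/and3P[_ _ /forall_inP]; apply.
have sub_in Q x : Q \in F -> x \in Q.2 -> Q.1 \subset ins o x.
  move=> QF xQ; apply/subsetP => v vQ; rewrite inE.
  by have := subsetP (sub_out Q v QF vQ) x xQ; rewrite inE.
(* Relations are encoded as sets of arcs, so that one with fewest squares can be picked from a
   finite type. *)
pose ok (E : {set T * T}) := let A : rel T := fun v x => (v, x) \in E in
  [&& [forall v, outs A v \subset outs o v], [forall v, #|outs A v| == 2],
      [forall x, #|ins A x| == 2] & [forall Q in F, alternates A Q]].
have [E0 okE0] : exists E, ok E.
  have [v|x|A Ao [A_out A_in]] := bisection o P R.
  - rewrite o_out; have [Q /andP[QF vQ]|no] := pickP [pred Q in F | v \in Q.1].
      by rewrite (defP Q) // sub_out // (Fcard Q QF).2.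
    by rewrite /P big_pred0 // sub0set cards0.
  - rewrite o_in; have [Q /andP[QF xQ]|no] := pickP [pred Q in F | x \in Q.2].
      by rewrite (defR Q) // sub_in // (Fcard Q QF).1.
    by rewrite /R big_pred0 // sub0set cards0.
  exists [set d | A d.1 d.2].
  have outE v : outs (fun v x => (v, x) \in [set d | A d.1 d.2]) v = outs A v.
    by apply/setP => x; rewrite !inE.
  have inE' x : ins (fun v x => (v, x) \in [set d | A d.1 d.2]) x = ins A x.
    by apply/setP => v; rewrite !inE.
  apply/and4P; split.
  - by apply/forallP => v; rewrite outE; apply/subsetP => x; rewrite !inE; apply: Ao.
  - by apply/forallP => v; rewrite outE -(inj_eq double_inj) (A_out v).1 o_out.
  - by apply/forallP => x; rewrite inE' -(inj_eq double_inj) (A_in x).1 o_in.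
  apply/forall_inP => Q QF; have [Q1 Q2] := Fcard Q QF.
  apply/andP; split; apply/forall_inP.
    by move=> v vQ; rewrite outE -(inj_eq double_inj) -(defP Q v QF vQ) (A_out v).2 (defP Q) // Q2.
  by move=> x xQ; rewrite inE' -(inj_eq double_inj) -(defR Q x QF xQ) (A_in x).2 (defR Q) // Q1.
pose squares (E : {set T * T}) := [set S | square (fun v x => (v, x) \in E) S].
case: (arg_minnP (fun E => #|squares E|) okE0) => E okE minE.
pose A : rel T := fun v x => (v, x) \in E; exists A.
  move=> v x Avx; have /and4P[/forallP/(_ v)/subsetP/(_ x)] := okE.
  by rewrite !inE => /(_ Avx).
have /and4P[/forallP Asub /forallP A_out /forallP A_in /forall_inP Aalt] := okE.
have Areg : two_regular A by split=> u; apply/eqP; [apply: A_out | apply: A_in].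
split=> // v w eq_vw; apply/eqP; apply: contraT => neq_vw; exfalso.
(* Two vertices with the same out-neighbours yield a square [N] of [A]; by maximality of [F] it
   meets some [Q] in [F], and toggling [Q] contradicts the minimality of [E]. *)
pose N := ([set v; w], outs A v).
have sqN : square A N.
  rewrite /square /= cards2 neq_vw Areg.1 /=; apply/forall_inP => u.
  by rewrite !inE => /orP[]/eqP->; rewrite ?eq_vw.
have [NO NI] := square_outs _ _ _ Areg sqN.
have NF : N \notin F.
  apply/negP => /Aalt/andP[/forall_inP/(_ v) + _]; rewrite setIid Areg.1 /=.
  by rewrite !inE eqxx => /(_ isT).
have [Q QF touch] : exists2 Q, Q \in F & ~~ ([disjoint N.1 & Q.1] && [disjoint N.2 & Q.2]).
  apply/exists_inP; apply: contraT; rewrite negb_exists_in => /forall_inP disN.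
  suff /Fmax : disjoint_squares o (N |: F) by rewrite cardsU1 NF ltnn.
  apply/andP; split.
    apply/forall_inP => S /setU1P[->|/Fsq //].
    case/and3P: sqN => N1 N2 /forall_inP sub; apply/and3P; split=> //.
    by apply/forall_inP => u /sub/subset_trans; apply.
  apply/forall_inP => S1 S1F; apply/forall_inP => S2 S2F; apply/implyP.
  case/setU1P: S1F S2F => [->|S1F] /setU1P[->|S2F]; rewrite ?eqxx // => neq.
  - by have := disN _ S2F; rewrite negbK.
  - have := disN _ S1F; rewrite negbK.
    by rewrite (disjoint_sym S1.1) (disjoint_sym S1.2).
  exact: Fdis.
have [Q1 Q2] := Fcard Q QF; have altQ := Aalt Q QF.
(* A vertex that [N] and [Q] share on the same side has an arc of [A] within [Q]; this arc also lies
   in [N], which takes up all arcs of [A] there. *)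
have [u [y [uN uQ yN yQ]]] : exists u y, [/\ u \in N.1, u \in Q.1, y \in N.2 & y \in Q.2].
  have /andP[/forall_inP altO /forall_inP altI] := altQ.
  have: ~~ [disjoint N.1 & Q.1] || ~~ [disjoint N.2 & Q.2] by rewrite -negb_and.
  case/orP=> /pred0Pn[z /andP[/= zN zQ]].
    have /eqP z1 := altO z zQ; have: 0 < #|outs A z :&: Q.2| by rewrite z1.
    by case/card_gt0P=> y; rewrite NO // inE => /andP[yN yQ]; exists z, y.
  have /eqP z1 := altI z zQ; have: 0 < #|ins A z :&: Q.1| by rewrite z1.
  by case/card_gt0P=> u; rewrite NI // inE => /andP[uN uQ]; exists u, z.
have := toggle_squares _ _ _ _ _ _ Areg Q1 Q2 altQ sqN uN uQ yN yQ.
move/proper_card; apply/negP; rewrite -leqNgt.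
pose E' := [set d | toggle A Q d.1 d.2].
have outE z : outs (fun v x => (v, x) \in E') z = outs (toggle A Q) z.
  by apply/setP => t; rewrite !inE.
have inE' z : ins (fun v x => (v, x) \in E') z = ins (toggle A Q) z.
  by apply/setP => t; rewrite !inE.
have -> : [set S | square (toggle A Q) S] = squares E'.
  apply/setP => S; rewrite !inE; congr [&& _, _ & _].
  by apply: eq_forallb_in => z _; rewrite outE.
have [altQ' [A'_out A'_in]] := alternates_toggle _ _ _ Q1 Q2 altQ Areg.
apply: minE; apply/and4P; split.
- apply/forallP => z; rewrite outE; apply/subsetP => t; rewrite inE /toggle.
  case: (boolP (_ && _)) => [/andP[zQ tQ] _|_]; first exact: subsetP (sub_out Q z QF zQ) t tQ.
  by rewrite addbF => Azt; apply: (subsetP (Asub z)); rewrite inE.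
- by apply/forallP => z; rewrite outE A'_out.
- by apply/forallP => z; rewrite inE' A'_in.
apply/forall_inP => S SF.
have -> : alternates (fun v x => (v, x) \in E') S = alternates (toggle A Q) S.
  by congr (_ && _); apply: eq_forallb_in => z _; rewrite ?outE ?inE'.
have [->//|neq] := eqVneq S Q.
by have /andP[d1 d2] := Fdis S Q SF QF neq; apply: alternates_toggle_disjoint => //; apply: Aalt.
Qed.

(** * Orienting and assigning the outer edges *)

Lemma one_out {T : finType} (c : rel T) :
  (forall v, #|outs c v| = 1) -> exists f : T -> T, forall v x, c v x = (x == f v).
Proof.
move=> c1; have /fin_all_exists[f fP] : forall v, exists x, outs c v = [set x].
  by move=> v; apply/cards1P/eqP.
by exists f => v x; rewrite -in_set1 -fP inE.
Qed.

(** One more bisection leaves two 1-regular digraphs, that is, graphs of permutations. *)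
Lemma two_permutations {T : finType} (A : rel T) : two_regular A ->
  exists f1 f2 : T -> T, [/\ bijective f1, bijective f2, forall v, f1 v != f2 v
    & forall v x, A v x = (x == f1 v) || (x == f2 v)].
Proof.
move=> [A_out A_in]; have even0 : ~~ odd #|@set0 T| by rewrite cards0.
have [v|x|c cA [c_out c_in]] := bisection A (fun=> set0) (fun=> set0).
- by rewrite A_out sub0set.
- by rewrite A_in sub0set.
pose d v x := A v x && ~~ c v x.
have c_out1 v : #|outs c v| = 1 by apply: double_inj; rewrite (c_out v).1 A_out.
have c_in1 x : #|ins c x| = 1 by apply: double_inj; rewrite (c_in x).1 A_in.
have d_out1 v : #|outs d v| = 1.
  have -> : outs d v = outs A v :\: outs c v by apply/setP => x; rewrite !inE andbC.
  rewrite cardsD (setIidPr _) ?A_out ?c_out1 //.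
  by apply/subsetP => x; rewrite !inE; apply: cA.
have d_in1 x : #|ins d x| = 1.
  have -> : ins d x = ins A x :\: ins c x by apply/setP => v; rewrite !inE andbC.
  rewrite cardsD (setIidPr _) ?A_in ?c_in1 //.
  by apply/subsetP => v; rewrite !inE; apply: cA.
have bij (r : rel T) (f : T -> T) :
    (forall x, #|ins r x| = 1) -> (forall v x, r v x = (x == f v)) -> bijective f.
  move=> r_in rf; apply: injF_bij => u v eq_uv.
  have r1 : #|ins r (f v)| <= 1 by rewrite r_in.
  by apply: (card_le1_eqP r1); rewrite inE rf ?eq_uv.
have [f1 f1P] := one_out c c_out1; have [f2 f2P] := one_out d d_out1.
exists f1, f2; split; [exact: bij f1P | exact: bij f2P | |] => v.
  have := f2P v (f2 v); rewrite eqxx /d f1P => /andP[_]; by rewrite eq_sym.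
by move=> x; rewrite -f1P -f2P /d; case: (boolP (c v x)) => [/cA->|_]; rewrite ?andbT.
Qed.

(* Pairing at [x] the edges to [t' x] and [t' (t' x)] makes one of them leave [x]
   and the other enter it. *)
Lemma orientation_along {T : finType} (b : rel T) (t' : T -> T) :
    symmetric b -> irreflexive b -> (forall x, #|outs b x| = 4) -> (forall x, t' x != x) ->
  exists2 o : rel T, forall x y, b x y = o x y (+) o y x &
    [/\ subrel o b, two_regular o, forall x, ~~ (o x (t' x) && o x (t' (t' x)))
      & forall x, ~~ (o (t' x) x && o (t' (t' x)) x)].
Proof.
move=> b_sym b_irr b4 t'_neq.
pose P x := if b x (t' x) && b x (t' (t' x)) then [set t' x; t' (t' x)] else set0.
have cardP x : b x (t' x) -> b x (t' (t' x)) -> P x = [set t' x; t' (t' x)] /\ #|P x| = 2.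
  by rewrite /P => -> ->; rewrite cards2 eq_sym t'_neq.
have [x|o oP [ob o_out o_in oPx]] := orientation b P b_sym b_irr.
  rewrite b4; split=> //; last first.
    by rewrite /P; case: ifP => [/andP[b1 b2]|_]; rewrite ?cards0 // cards2 eq_sym t'_neq.
  rewrite /P; case: ifP => [/andP[b1 b2]|_]; last exact: sub0set.
  by apply/subsetP => y; rewrite !inE => /orP[]/eqP->.
have o_asym x y : o x y -> o y x = false.
  by move=> oxy; have := ob _ _ oxy; rewrite oP oxy => /negPf.
exists o => //; split=> //.
- by split=> x; apply: double_inj; rewrite ?o_out ?o_in b4.
- move=> x; apply/negP => /andP[o1 o2]; have [PE P2] := cardP x (ob _ _ o1) (ob _ _ o2).
  have := oPx x; rewrite (setIidPr _) ?P2 // PE.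
  by apply/subsetP => y; rewrite !inE => /orP[]/eqP->.
move=> x; apply/negP => /andP[o1 o2].
have [PE P2] : P x = [set t' x; t' (t' x)] /\ #|P x| = 2 by apply: cardP; rewrite b_sym ob.
have := oPx x; rewrite P2 (_ : _ :&: _ = set0) ?cards0 //.
apply/setP => y; rewrite PE !inE; apply/negP => /andP[oxy /orP[]/eqP eq_y]; subst y.
  by rewrite o_asym in oxy.
by rewrite o_asym in oxy.
Qed.

(* The arcs [x -> g1 x] and [x -> g2 x] get attached to the paths whose inner part
   joins [x] to [t x] and to [t' x] respectively. Fix the order of the two arcs at
   each [x] so as to satisfy the conditions at [x] alone and to minimise the number
   of clashes [g1 x = g2 (t x)]; then swapping at [x] or at [t x] removes a clash
   without creating any, because [g1 x] has only two in-neighbours. *)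
Lemma arc_assignment {T : finType} (o : rel T) (t t' : T -> T) :
    cancel t t' -> cancel t' t -> (forall x, t x != x) -> (forall x, t (t x) != x) ->
    two_regular o -> (forall x y, o x y -> ~~ o y x) ->
    (forall x, ~~ (o x (t' x) && o x (t' (t' x)))) ->
    (forall x, ~~ (o (t' x) x && o (t' (t' x)) x)) ->
  exists g1 g2 : T -> T,
    [/\ forall x y, o x y = (y == g1 x) || (y == g2 x), forall x, g1 x != g2 x,
        forall x, g1 x != t x, forall x, g2 x != t' x & forall x, g1 x != g2 (t x)].
Proof.
move=> tK t'K t1 t2 [o_out o_in] o_asym no_out no_in.
have [p [q pq]] : exists p q : T -> T, forall x, p x != q x /\ outs o x = [set p x; q x].
  have /fin_all_exists[p pP] : forall x, exists u, exists y, u != y /\ outs o x = [set u; y].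
    by move=> x; apply/cards2P/eqP.
  by have /fin_all_exists[q qP] := pP; exists p, q.
pose g1 (s : {ffun T -> bool}) x := if s x then p x else q x.
pose g2 (s : {ffun T -> bool}) x := if s x then q x else p x.
have g_neq s x : g1 s x != g2 s x.
  by have [neq _] := pq x; rewrite /g1 /g2; case: (s x); rewrite // eq_sym.
have oE s x y : o x y = (y == g1 s x) || (y == g2 s x).
  have -> : o x y = (y \in outs o x) by rewrite inE.
  by have [_ ->] := pq x; rewrite !inE /g1 /g2; case: (s x) => //; rewrite orbC.
have og1 s x : o x (g1 s x) by rewrite (oE s) eqxx.
have og2 s x : o x (g2 s x) by rewrite (oE s) eqxx orbT.
have tt' x : t x != t' x by rewrite -(inj_eq (can_inj tK)) t'K.
pose ok (s : {ffun T -> bool}) := [forall x, (g1 s x != t x) && (g2 s x != t' x)].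
have [s0 ok0] : exists s, ok s.
  (* [q x] comes first unless this violates a condition at [x]; then the other order works because
     [t x] and [t' x] differ. *)
  exists [ffun x => (q x == t x) || (p x == t' x)]; apply/forallP => x.
  rewrite /g1 /g2 ffunE; have [neq _] := pq x.
  have [qt|qt] /= := eqVneq (q x) (t x); first by rewrite -{1}qt neq qt tt'.
  have [pt|pt] /= := eqVneq (p x) (t' x); last by rewrite qt pt.
  by rewrite -pt [q x == _]eq_sym neq pt eq_sym tt'.
pose clash (s : {ffun T -> bool}) := [set x | g1 s x == g2 s (t x)].
case: (arg_minnP (fun s => #|clash s|) ok0) => s /forallP oks mins.
exists (g1 s), (g2 s); split=> // x; try by case/andP: (oks x).
apply: contraT; rewrite negbK => /eqP cl.
pose sw y : {ffun T -> bool} := [ffun z => s z (+) (z == y)].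
have swE y z : z != y -> g1 (sw y) z = g1 s z /\ g2 (sw y) z = g2 s z.
  by move=> neq; rewrite /g1 /g2 ffunE (negPf neq) addbF.
have swy y : g1 (sw y) y = g2 s y /\ g2 (sw y) y = g1 s y.
  by rewrite /g1 /g2 ffunE eqxx addbT; case: (s y).
have ok_sw y : g2 s y != t y -> g1 s y != t' y -> ok (sw y).
  move=> n2 n1; apply/forallP => z; have [->|/swE[-> ->]] := eqVneq z y; last exact: oks.
  by have [-> ->] := swy y; rewrite n1 n2.
have no3 u y z v : u != y -> y != z -> u != z -> o u v -> o y v -> ~~ o z v.
  move=> uy yz uz ou oy; apply/negP => oz; have: #|u |: [set y; z]| <= #|ins o v|.
    by apply/subset_leq_card/subsetP => w; rewrite !inE => /or3P[]/eqP->.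
  by rewrite o_in cardsU1 cards2 !inE negb_or uy uz yz.
have fewer y : clash (sw y) \subset clash s -> x \notin clash (sw y) -> ok (sw y) -> False.
  move=> sub xC /mins; rewrite leqNgt => /negP; apply; apply: proper_card.
  by apply/properP; split=> //; exists x; rewrite // inE cl.
have xtx : x != t x by rewrite eq_sym.
(* By minimality the conditions at [t x] must forbid a swap there: the only clash it could create,
   at [t x], would give [g1 s x] the three in-neighbours [x], [t x] and [t (t x)]. *)
have bad_tx : (g2 s (t x) == t (t x)) || (g1 s (t x) == x).
  apply: contraT; rewrite negb_or => /andP[n2 n1].
  have xC : x \notin clash (sw (t x)).
    by rewrite inE (swE _ _ xtx).1 (swy _).2 cl eq_sym g_neq.
  exfalso; apply: (fewer (t x)) (xC) (ok_sw _ n2 _); last by rewrite tK.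
  apply/subsetP => z zC; have neq_zx : z != x by apply: contraTneq zC => ->.
  have [eq_z|neq_z] := eqVneq z (t x).
    move: zC; rewrite eq_z inE (swy _).1 (swE _ _ (t1 _)).2 -cl => /eqP cl2.
    have := no3 x (t x) (t (t x)) (g1 s x); rewrite xtx ![_ == t (t x)]eq_sym t1 t2.
    by rewrite {3}cl2 og2 og1 {1}cl og2 => /(_ isT isT isT isT isT).
  have neq_tz : t z != t x by rewrite (inj_eq (can_inj tK)).
  by move: zC; rewrite !inE (swE _ _ neq_z).1 (swE _ _ neq_tz).2.
(* Likewise for a swap at [x]: a new clash could only occur at [t' x], a third in-neighbour of
   [g1 s x] besides [x] and [t x]. *)
have bad_x : (g2 s x == t x) || (g1 s x == t' x).
  apply: contraT; rewrite negb_or => /andP[n2 n1].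
  have xC : x \notin clash (sw x).
    by rewrite inE (swE _ _ (t1 x)).2 (swy _).1 -cl eq_sym g_neq.
  exfalso; apply: (fewer x) (xC) (ok_sw _ n2 n1).
  apply/subsetP => z zC; have neq_zx : z != x by apply: contraTneq zC => ->.
  have [eq_z|neq_z] := eqVneq (t z) x.
    move: zC; rewrite inE eq_z (swE _ _ neq_zx).1 (swy _).2 => /eqP cl2.
    have neq_ztx : z != t x by rewrite eq_sym -eq_z t2.
    have := no3 z x (t x) (g1 s x) neq_zx xtx neq_ztx.
    by rewrite -{1}cl2 {2}cl !og1 og2 => /(_ isT isT).
  by move: zC; rewrite !inE (swE _ _ neq_zx).1 (swE _ _ neq_z).2.
have o1 : o x (g2 s (t x)) by rewrite -cl.
(* If [g2 s (t x)] is [t (t x)], the arcs to it from [x] and [t x] violate [no_in]. Otherwise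
   [t x -> x] is an arc, which is either opposite to an arc [x -> t x] or, together with
   [t x -> t' x], violates [no_out]. *)
case/orP: bad_tx => /eqP ex; case/orP: bad_x => /eqP ey.
- by have := no_in (t (t x)); rewrite !tK -ex og2 o1.
- by have := no_in (t (t x)); rewrite !tK -ex og2 o1.
- have oxt : o x (t x) by rewrite -ey og2.
  by have := o_asym _ _ oxt; rewrite -{2}ex og1.
have otx : o (t x) x by rewrite -{2}ex og1.
by have := no_out (t x); rewrite !tK otx -ey cl og2.
Qed.

(** * Assembling the paths *)

(* An intrinsic description of the two ends of a path with edge set [E]: they are
   the vertices with exactly one neighbour. *)
Definition leaf {T : finType} (E : {set {set T}}) (w : T) : Prop :=
  exists x, forall y, ([set w; y] \in E) = (y == x).

Lemma leaf_path {T : finType} (a b c d f w : T) : uniq [:: a; b; c; d; f] ->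
  leaf (walk_edges [:: a; b; c; d; f]) w <-> (w == a) || (w == f).
Proof.
rewrite /= !inE !negb_or !andbT => /and4P[/and4P[ab ac ad af] /and3P[bc bd bf] /andP[cd cf] df].
set E := walk_edges _; have memE y : ([set w; y] \in E) =
    [|| [set w; y] == [set a; b], [set w; y] == [set b; c], [set w; y] == [set c; d]
      | [set w; y] == [set d; f]] by rewrite !inE.
split=> [[x xP]|/orP[]/eqP eq_w].
- have {}xP y := etrans (esym (memE y)) (xP y).
  have two y z : y != z -> [|| [set w; y] == [set a; b], [set w; y] == [set b; c],
      [set w; y] == [set c; d] | [set w; y] == [set d; f]] ->
      [|| [set w; z] == [set a; b], [set w; z] == [set b; c],
      [set w; z] == [set c; d] | [set w; z] == [set d; f]] -> False.
    by move=> neq; rewrite !xP => /eqP eq_y /eqP eq_z; rewrite eq_y eq_z eqxx in neq.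
  have := xP x; rewrite eqxx !eq_set2.
  have [-> //|wa] := eqVneq w a; have [-> //|wf] := eqVneq w f.
  have [eq_w|wb] := eqVneq w b.
    by case: (two a c ac); rewrite eq_w !eq_set2 !eqxx ?orbT.
  have [eq_w|wc] := eqVneq w c.
    by case: (two b d bd); rewrite eq_w !eq_set2 !eqxx ?orbT.
  have [eq_w|wd] := eqVneq w d.
    by case: (two c f cf); rewrite eq_w !eq_set2 !eqxx ?orbT.
  by rewrite /= ?orbF.
- exists b => y; rewrite memE eq_w !eq_set2 eqxx.
  by rewrite (negPf ab) (negPf ac) (negPf ad) (negPf af) /= ?orbF.
exists d => y; rewrite memE eq_w !eq_set2 eqxx ![f == _]eq_sym.
by rewrite (negPf af) (negPf bf) (negPf cf) (negPf df) /= ?orbF.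
Qed.

(** [end_vertex] allows any vertex sequence tracing the path; since leaves depend on the edge set
    alone, one known sequence decides. *)
Lemma end_vertex_path {T : finType} (a b c d f w : T) : uniq [:: a; b; c; d; f] ->
  end_vertex 4 ([set:: [:: a; b; c; d; f]], walk_edges [:: a; b; c; d; f]) w
    = (w == a) || (w == f).
Proof.
move=> p_uniq; apply/existsP/idP => [[q]|w_end].
  case: q => -[|a' [|b' [|c' [|d' [|f' [|? ?]]]]]] //= sz.
  rewrite !(tnth_nth a') /= => /andP[/and3P[q_uniq _ /eqP/= eq_edges]].
  move/(leaf_path _ _ _ _ _ _ q_uniq); rewrite -eq_edges.
  by move/(leaf_path _ _ _ _ _ _ p_uniq).
exists [tuple a; b; c; d; f]; rewrite !(tnth_nth a) /= w_end andbT.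
by apply/and3P.
Qed.

(** The path of [u] prolongs both arcs of [A] leaving [u]. As [f1] and [f2] are bijective, each arc
    of [o] is used once, so the paths ending at [w] correspond to the two arcs of [o] entering
    [w]. *)
Lemma balanced_paths {T : finType} (e A o : rel T) (f1 f1' f2 f2' g1 g2 : T -> T) :
    cancel f1 f1' -> cancel f1' f1 -> cancel f2 f2' -> cancel f2' f2 ->
    (forall v x, A v x = (x == f1 v) || (x == f2 v)) ->
    (forall x y, o x y = (y == g1 x) || (y == g2 x)) ->
    (forall v, f1 v != f2 v) -> (forall x, g1 x != g2 x) -> (forall x, #|ins o x| = 2) ->
    (forall x y, e x y = (A x y || o x y) || (A y x || o y x)) ->
    (forall x y, A x y || o x y -> ~~ (A y x || o y x)) ->
    (forall x y, A x y -> ~~ o x y) ->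
    (forall v, g1 (f1 v) != f2 v) -> (forall v, g2 (f2 v) != f1 v) ->
    (forall v, g1 (f1 v) != g2 (f2 v)) ->
  exists D : {set subgraph T}, path_decomposition e 4 D /\ balanced 4 D.
Proof.
move=> f1K f1'K f2K f2'K AE oE f_neq g_neq o_in eE asym Ao g1f2 g2f1 g12.
pose arc x y := A x y || o x y.
have Af1 v : A v (f1 v) by rewrite AE eqxx.
have Af2 v : A v (f2 v) by rewrite AE eqxx orbT.
have og1 x : o x (g1 x) by rewrite oE eqxx.
have og2 x : o x (g2 x) by rewrite oE eqxx orbT.
have arcA x y : A x y -> arc x y by rewrite /arc => ->.
have arco x y : o x y -> arc x y by rewrite /arc => ->; rewrite orbT.
have arc_neq x y : arc x y -> x != y.
  by move=> xy; apply: contraL (xy) => /eqP eq_xy; have := asym x y xy; rewrite eq_xy.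
pose p u := [:: g1 (f1 u); f1 u; u; f2 u; g2 (f2 u)].
have p_uniq u : uniq (p u).
  have ne1 : u != g1 (f1 u).
    by apply: contraTneq (og1 (f1 u)) => <-; have := asym _ _ (arcA _ _ (Af1 u)); case/norP.
  have ne2 : u != g2 (f2 u).
    by apply: contraTneq (og2 (f2 u)) => <-; have := asym _ _ (arcA _ _ (Af2 u)); case/norP.
  rewrite /= !inE !negb_or [g1 _ == f1 u]eq_sym arc_neq ?arco // eq_sym ne1 g1f2 g12.
  rewrite [f1 u == u]eq_sym arc_neq ?arcA // f_neq eq_sym g2f1.
  by rewrite arc_neq ?arcA // ne2 arc_neq ?arco.
pose trail u : subgraph T := ([set:: p u], walk_edges (p u)).
have trailE u a : (a \in (trail u).2) =
    [|| a == [set g1 (f1 u); f1 u], a == [set f1 u; u], a == [set u; f2 u]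
      | a == [set f2 u; g2 (f2 u)]] by rewrite !inE.
(* The index of the path through the arc [x -> y]: its tail for an arc of [A], otherwise the
   preimage of its tail under [f1] or [f2]. *)
pose owner x y := if A x y then x else if y == g1 x then f1' x else f2' x.
have ownerP u a : a \in (trail u).2 -> exists x y, [/\ a = [set x; y], arc x y & owner x y = u].
  rewrite trailE => /or4P[]/eqP->.
  - exists (f1 u), (g1 (f1 u)); rewrite setUC arco // /owner eqxx f1K.
    by rewrite (negPf (contraL (Ao _ _) (og1 _))).
  - by exists u, (f1 u); rewrite setUC arcA // /owner Af1.
  - by exists u, (f2 u); rewrite arcA // /owner Af2.
  exists (f2 u), (g2 (f2 u)); rewrite arco // /owner eq_sym (negPf (g_neq _)) f2K.
  by rewrite (negPf (contraL (Ao _ _) (og2 _))).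
have owner_arc x y : arc x y -> [set x; y] \in (trail (owner x y)).2.
  rewrite trailE /owner /arc; case: ifP => [Axy _|_ /=].
    by move: Axy; rewrite AE => /orP[]/eqP->; rewrite ?[[set f1 x; x]]setUC eqxx ?orbT.
  rewrite oE; case: eqP => [-> _|_ /eqP->]; first by rewrite f1'K setUC eqxx.
  by rewrite f2'K eqxx !orbT.
(* By [asym] only one direction of an edge is an arc, so the edge determines its path. *)
have own_inj u w a : a \in (trail u).2 -> a \in (trail w).2 -> u = w.
  move=> /ownerP[x [y [-> xy <-]]] /ownerP[z [t [/eqP eq_a zt <-]]].
  move: eq_a; rewrite eq_set2 => /orP[]/andP[/eqP ex /eqP ey]; first by rewrite ex ey.
  by have := asym _ _ zt; rewrite -ex -ey -/(arc x y) xy.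
have trail_inj : injective trail.
  move=> u w eq_uw; apply: (own_inj u w [set f1 u; u]); last rewrite -eq_uw.
    by rewrite trailE eqxx orbT.
  by rewrite trailE eqxx orbT.
exists [set trail u | u : T]; split; first split.
- move=> _ /imsetP[u _ ->]; split.
    by apply/existsP; exists [tuple of p u]; rewrite /traces p_uniq !eqxx.
  apply/subsetP => _ /ownerP[x [y [-> xy _]]]; apply/imset2P.
  by exists x y; rewrite // inE eE -/(arc x y) xy.
- move=> _ _ /imsetP[u _ ->] /imsetP[w _ ->] neq; apply/pred0P => a /=.
  apply: contraNF neq => /andP[au aw]; by rewrite (own_inj u w a).
- move=> _ /imset2P[x y _ + ->]; rewrite inE eE => /andP[_ xy].
  case/orP: xy => [xy|yx].
    by exists (trail (owner x y)); [apply: imset_f | apply: owner_arc].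
  by exists (trail (owner y x)); [apply: imset_f | rewrite setUC; apply: owner_arc].
move=> w; pose G1 := [set x | w == g1 x]; pose G2 := [set x | w == g2 x].
have endE u : end_vertex 4 (trail u) w = (w == g1 (f1 u)) || (w == g2 (f2 u)).
  exact: end_vertex_path (p_uniq u).
have -> : [set H in [set trail u | u : T] | end_vertex 4 H w] =
          trail @: (f1 @^-1: G1 :|: f2 @^-1: G2).
  apply/setP => H; rewrite inE; apply/andP/imsetP => [[/imsetP[u _ ->]]|[u + ->]].
    by rewrite endE => w_end; exists u; rewrite // !inE.
  by rewrite endE !inE; split; first exact: imset_f.
have dis (E F : {set T}) : E :&: F = set0 -> #|E :|: F| = #|E| + #|F|.
  by move=> EF; rewrite cardsU EF cards0 subn0.
rewrite card_imset // dis; last first.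
  by apply/setP => u; rewrite !inE; case: eqP => // ->; rewrite (negPf (g12 u)).
rewrite !card_preimset; [|exact: can_inj f2K|exact: can_inj f1K].
rewrite -dis; last by apply/setP => x; rewrite !inE; case: eqP => // ->; rewrite (negPf (g_neq x)).
by rewrite -(o_in w); apply: eq_card => x; rewrite !inE oE.
Qed.

(** * Combining the splittings of an 8-regular graph *)

Theorem corollary3p4 (T : finType) (e : rel T)
    (e_sym : symmetric e) (e_irr : irreflexive e) (e_reg : regular e 8) :
  exists D : {set subgraph T}, path_decomposition e 4 D /\ balanced 4 D.
Proof.
have [x|o eE [oe o_out o_in _]] := orientation e (fun=> set0) e_sym e_irr.
  by rewrite sub0set cards0 [#|_|]e_reg.
have o_asym x y : o x y -> o y x = false.
  by move=> oxy; have := oe _ _ oxy; rewrite eE oxy => /negPf.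
have [v|x|A Ao [Areg A_inj]] := square_free_factor o.
- by apply: double_inj; rewrite o_out [#|_|]e_reg.
- by apply: double_inj; rewrite o_in [#|_|]e_reg.
have A_asym x y : A x y -> A y x = false.
  by move=> /Ao/o_asym; apply: contraFF; apply: Ao.
have [f1 [f2 [[f1' f1K f1'K] [f2' f2K f2'K] f_neq AE]]] := two_permutations A Areg.
pose t x := f2 (f1' x); pose t' x := f1 (f2' x).
have tK : cancel t t' by move=> x; rewrite /t /t' f2K f1'K.
have t'K : cancel t' t by move=> x; rewrite /t /t' f1K f2'K.
have t1 x : t x != x by rewrite /t -{2}(f1'K x) eq_sym f_neq.
(* A 2-cycle would give [f1' x] and [f1' (t x)] the same out-neighbours, [x] and [t x]. *)
have t2 x : t (t x) != x.
  apply/eqP => eq_x; have /A_inj eq_v : outs A (f1' x) = outs A (f1' (t x)).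
    by apply/setP => y; rewrite !inE !AE !f1'K -/(t x) -/(t (t x)) eq_x orbC.
  by have := t1 x; rewrite -{1}(f1'K (t x)) -eq_v f1'K eqxx.
(* Of the orientation [o] only the part [A] is kept; the other edges form the 4-regular graph [b]
   and are oriented afresh, in a way that depends on [t']. *)
pose b x y := e x y && ~~ (A x y || A y x).
have b_sym : symmetric b by move=> x y; rewrite /b e_sym orbC.
have b_irr : irreflexive b by move=> x; rewrite /b e_irr.
have Ae x y : A x y -> e x y by move/Ao/oe.
have b4 x : #|outs b x| = 4.
  have -> : outs b x = [set y | e x y] :\: (outs A x :|: ins A x).
    by apply/setP => y; rewrite !inE andbC.
  rewrite cardsD (setIidPr _) ?e_reg; last first.
    by apply/subsetP => y; rewrite !inE => /orP[/Ae//|/Ae]; rewrite e_sym.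
  rewrite cardsU (_ : _ :&: _ = set0) ?cards0; last first.
    by apply/setP => y; rewrite !inE; apply/andP => -[/A_asym->].
  by rewrite Areg.1 Areg.2.
have t'1 x : t' x != x by rewrite -(inj_eq (can_inj tK)) t'K eq_sym.
have [r bE [rb rreg no_out no_in]] := orientation_along b t' b_sym b_irr b4 t'1.
have r_asym x y : r x y -> ~~ r y x by move=> rxy; have := rb _ _ rxy; rewrite bE rxy.
have [g1 [g2 [rE g_neq g1t g2t g12]]] :=
  arc_assignment r t t' tK t'K t1 t2 rreg r_asym no_out no_in.
have Ar x y : A x y -> ~~ r x y /\ ~~ r y x.
  by move=> Axy; split; apply/negP => /rb; rewrite /b Axy ?orbT andbF.
apply: (balanced_paths e A r f1 f1' f2 f2' g1 g2) => //.
- exact: rreg.2.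
- move=> x y; have [Axy|nAxy] := boolP (A x y); first by rewrite Ae.
  have [Ayx|nAyx] := boolP (A y x); first by rewrite e_sym Ae // orbT.
  have := bE x y; rewrite /b (negPf nAxy) (negPf nAyx) andbT => -> /=.
  by have := r_asym x y; case: (r x y) (r y x) => [] [] // /(_ isT).
- move=> x y /orP[Axy|rxy].
    by have [_ /negPf->] := Ar x y Axy; rewrite A_asym.
  by rewrite (negPf (r_asym _ _ rxy)) orbF; apply/negP => /Ar[_]; rewrite rxy.
- by move=> x y /Ar[].
(* Since [t (f1 v)] is [f2 v], the conditions on [g1] and [g2] become the distinctness of the
   vertices of the path of [v]. *)
- by move=> v; have := g1t (f1 v); rewrite /t f1K.
- by move=> v; have := g2t (f2 v); rewrite /t' f2K.
by move=> v; have := g12 (f1 v); rewrite /t f1K.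
Qed.
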